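(* There exist $n\in\mathbf{N}$ and $\epsilon>0$ such that the following holds. For any finite system $\Sigma_0(\vec w)$ of equations and inequations in a finite set of variables $\vec w$ that has a solution in some group, there is a finite system $\Sigma(\vec w,\vec z,\vec x)$ of equations and inequations that has a solution in some group, where $\vec w$, $\vec z$ and $\vec x$ are finite disjoint sets of variables and $\vec x=(x_1,\ldots,x_n)$ has length $n$, such that $\Sigma_0\subseteq\Sigma$ and such that, for any group $G$ and any $\vec a\in G^n$, if $\Sigma(\vec w,\vec z,\vec a)$ has a solution in $G$ (i.e. there are tuples $\vec b,\vec c$ from $G$ such that $\Sigma(\vec b,\vec c,\vec a)$ holds in $G$), then there is no $(\vec a,\epsilon)$-Følner subset of $G$.
   Context: An equation in some variables is an expression $w=e$ with $w$ a group word in those variables and their inverses, and an inequation is an expression $w\neq e$. A solution of a system in a group is an assignment of group elements to the variables making all the equations and inequations in the system true simultaneously. For a group $G$, a finite subset $F\subseteq G$ and $\epsilon>0$, a finite subset $H\subseteq G$ is called an $(F,\epsilon)$-Følner set if $|gH\triangle H|<\epsilon|H|$ for all $g\in F$. For a tuple $\vec a=(a_1,\ldots,a_n)\in G^n$, an $(\vec a,\epsilon)$-Følner set means an $(\{a_1,\ldots,a_n\},\epsilon)$-Følner set. *)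

(* Defs.v *)
From HB Require Import structures.
From mathcomp Require Import all_boot all_order all_algebra all_fingroup.
From mathcomp Require Import finmap.
From mathcomp Require Import reals.

Set Implicit Arguments.
Unset Strict Implicit.
Unset Printing Implicit Defensive.

Import Order.TTheory GRing.Theory Num.Theory.

(* The letter (x, false) stands for x and (x, true) for x^-1. *)
Definition word (X : Type) := seq (X * bool).

Definition rename_word (X Y : Type) (f : X -> Y) (w : word X) : word Y :=
  [seq (f l.1, l.2) | l <- w].

Definition eval_word (X : Type) (G : groupType) (v : X -> G) (w : word X) : G :=
  (\prod_(l <- w) (if l.2 then (v l.1)^-1 else v l.1))%g.

(* A word w in [equations] stands for w = e, and in [inequations] for w <> e. *)
Record system (X : Type) := System {
  equations : seq (word X);
  inequations : seq (word X)
}.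

Definition is_solution (X : finType) (S : system X) (G : groupType)
    (v : X -> G) : Prop :=
  (forall w, w \in equations S -> eval_word v w = 1%g) /\
  (forall w, w \in inequations S -> eval_word v w <> 1%g).

(* A groupType carries a choice operator besides its group structure; under the
   axiom of choice this does not restrict the groups considered. *)
Definition solvable_in_some_group (X : finType) (S : system X) : Prop :=
  exists (G : groupType) (v : X -> G), is_solution S v.

Definition rename_system (X Y : Type) (f : X -> Y) (S : system X) : system Y :=
  System (map (rename_word f) (equations S))
         (map (rename_word f) (inequations S)).

Definition subsystem (X : finType) (S T : system X) : Prop :=
  {subset equations S <= equations T} /\
  {subset inequations S <= inequations T}.

(* Disjoint tuples of variables w, z, x are encoded by a sum of index types. *)
Definition assignment3 (W Z I : Type) (G : Type)
    (b : W -> G) (c : Z -> G) (a : I -> G) (t : W + Z + I) : G :=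
  match t with
  | inl (inl w) => b w
  | inl (inr z) => c z
  | inr i => a i
  end.

Definition ltranslate (G : groupType) (g : G) (H : {fset G}) : {fset G} :=
  [fset (g * h)%g | h in H]%fset.

Definition symdiff (G : groupType) (A B : {fset G}) : {fset G} :=
  ((A `\` B) `|` (B `\` A))%fset.

Definition Folner (R : realType) (G : groupType) (F : {fset G}) (eps : R)
    (H : {fset G}) : Prop :=
  forall g, g \in F ->
    (#|` symdiff (ltranslate g H) H|%:R < eps * #|` H|%:R)%R.

Definition tuple_Folner (R : realType) (G : groupType) (n : nat)
    (a : 'I_n -> G) (eps : R) (H : {fset G}) : Prop :=
  Folner [fset a i | i : 'I_n]%fset eps H.

(* Main.v *)
(* Take elements s, t of orders 2 and 3 in a group, and let E be the
   subgroup generated by c, d, q1, q2 and their conjugates by t s. Finitely many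
   equations make E stable under conjugation by t s and t^-1 s, make E commute
   with E^s, and make q1^s, q2^s commute with t. By induction on the length of
   a reduced word f in s and t, the conjugates of q1^s and q2^s by f^-1 then
   lie in E if f starts with s, and in E^s otherwise. An element with reduced
   words of both kinds would thus force [q1, q2] = 1. So [q1, q2] <> 1 implies
   that s, t generate a free product Z/2 * Z/3, which bounds below the expansion
   of every finite set under left multiplication by s and t. A solution exists
   among the permutations of a set made of rooted binary trees, and hence, after
   taking a direct product, together with a solution of any solvable system. *)
Require Import Defs.
From HB Require Import structures.
From mathcomp Require Import all_boot all_order all_algebra all_fingroup.
From mathcomp Require Import finmap.
From mathcomp Require Import boolp reals zify lra.

Set Implicit Arguments.
Unset Strict Implicit.
Unset Printing Implicit Defensive.

Import Order.TTheory GRing.Theory Num.Theory.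
Local Open Scope group_scope.

(** * Generated subgroups and the list of relators *)

Inductive span (G : groupType) (S : seq G) : G -> Prop :=
| span1 : span S 1
| span_gen x : x \in S -> span S x
| spanM x y : span S x -> span S y -> span S (x * y)
| spanV x : span S x -> span S x^-1.

Lemma span_commute (G : groupType) (S : seq G) (x y : G) :
  (forall z, z \in S -> commute y z) -> span S x -> commute y x.
Proof.
move=> yS; elim=> [|z /yS//|z w _ yz _ yw|z _ yz].
- exact: commute1.
- exact: commuteM.
- exact: commuteV.
Qed.

Lemma span_conj (G : groupType) (S S' : seq G) (x y : G) :
  (forall z, z \in S -> span S' (z ^ y)) -> span S x -> span S' (x ^ y).
Proof.
move=> yS; elim=> [|z /yS//|z w _ yz _ yw|z _ yz].
- by rewrite conj1g; apply: span1.
- by rewrite conjMg; apply: spanM.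
- by rewrite conjVg; apply: spanV.
Qed.

(* The relators are expressed over bare operations, so as to be read both on
   words and on group elements. *)
Section Relators.
Variables (M : Type) (mul : M -> M -> M) (inv : M -> M).

Definition conj_op x y := mul (inv y) (mul x y).
Definition comm_op x y := mul (inv x) (conj_op x y).
Definition div_op x y := mul x (inv y).

Definition relgens (s t c d q1 q2 : M) : seq M :=
  [:: c; d; q1; q2] ++ [seq conj_op g (mul t s) | g <- [:: c; d; q1; q2]].

Definition relators (s t c d q1 q2 : M) : seq M :=
  [:: mul s s; mul t (mul t t);
      comm_op (conj_op q1 s) t; comm_op (conj_op q2 s) t]
  ++ [seq div_op (conj_op (conj_op (conj_op g (mul t s)) (mul t s)) c)
                 (conj_op g (mul t s)) | g <- [:: c; d; q1; q2]]
  ++ [seq div_op (conj_op g (mul (inv t) s)) (conj_op (conj_op g (mul t s)) d)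
       | g <- relgens s t c d q1 q2]
  ++ [seq comm_op g (conj_op h s)
       | g <- relgens s t c d q1 q2, h <- relgens s t c d q1 q2].

End Relators.

(** Serves both for evaluating words in a group and for embedding the model in a direct product. *)
Lemma map_relators (M N : Type) mulM invM mulN invN (f : M -> N)
    (s t c d q1 q2 : M) :
  {morph f : x y / mulM x y >-> mulN x y} ->
  {morph f : x / invM x >-> invN x} ->
  map f (relators mulM invM s t c d q1 q2) =
  relators mulN invN (f s) (f t) (f c) (f d) (f q1) (f q2).
Proof.
move=> fM fV.
have fconj x y : f (conj_op mulM invM x y) = conj_op mulN invN (f x) (f y).
  by rewrite /conj_op !fM fV.
have fcomm x y : f (comm_op mulM invM x y) = comm_op mulN invN (f x) (f y).
  by rewrite /comm_op fM fV fconj.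
have fdiv x y : f (div_op mulM invM x y) = div_op mulN invN (f x) (f y).
  by rewrite /div_op fM fV.
have fgens : relgens mulN invN (f s) (f t) (f c) (f d) (f q1) (f q2) =
    map f (relgens mulM invM s t c d q1 q2).
  by rewrite /relgens /= !fconj fM.
rewrite /relators {}fgens; move: (relgens _ _ _ _ _ _ _ _) => gens.
rewrite !map_cat; congr (_ ++ (_ ++ (_ ++ _))).
- by rewrite /= !fcomm !fconj !fM.
- by rewrite /= !fdiv !fconj !fM.
- rewrite -!map_comp; apply: eq_map => g /=.
  by rewrite fdiv !fconj !fM fV.
- rewrite map_allpairs allpairs_mapl allpairs_mapr.
  apply: eq_allpairs => g h.
  by rewrite fcomm fconj.
Qed.

(** * Ping-pong derived from the relators *)

Section PingPong.
Variables (G : groupType) (s t c d q1 q2 : G).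

Hypothesis rel : all (eq_op^~ 1) (relators *%g (@inv G) s t c d q1 q2).
Hypothesis ncomm : [~ q1, q2] <> 1.

Let generators := relgens *%g (@inv G) s t c d q1 q2.

Lemma relatorsP :
  [/\ s * s = 1, t * (t * t) = 1 &
      commute (q1 ^ s) t /\ commute (q2 ^ s) t] /\
  [/\ {in [:: c; d; q1; q2],
        forall g, ((g ^ (t * s)) ^ (t * s)) ^ c = g ^ (t * s)},
      {in generators, forall g, g ^ (t^-1 * s) = (g ^ (t * s)) ^ d} &
      {in generators &, forall g h, commute g (h ^ s)}].
Proof.
move: rel; rewrite /relators -/generators; move: generators => gens.
rewrite !all_cat 2!all_map => /and4P[/and5P[]].
move=> /eqP ss /eqP ttt /commgP c1 /commgP c2 _ /allP H1 /allP H2.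
move=> /all_allpairsP H3; split; split=> //.
- by move=> g gE; apply: divg1_eq; apply/eqP; exact: H1.
- by move=> g gE; apply: divg1_eq; apply/eqP; exact: H2.
- by move=> g h gE hE; apply/commgP/H3.
Qed.

Let E := span generators.

Let ss : s * s = 1. Proof. by case: relatorsP => [] []. Qed.
Let sV : s^-1 = s. Proof. exact: mulg1_eq ss. Qed.
Let ttt : t * (t * t) = 1. Proof. by case: relatorsP => [] []. Qed.
Let tV : t^-1 = t * t. Proof. exact: mulg1_eq ttt. Qed.

Lemma span_base g : g \in [:: c; d; q1; q2] -> E g.
Proof.
by move=> gb; apply: span_gen; rewrite /generators /relgens mem_cat gb.
Qed.

Lemma span_base_ts g : g \in [:: c; d; q1; q2] -> E (g ^ (t * s)).
Proof.
move=> gb; apply: span_gen; rewrite /generators /relgens mem_cat.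
by apply/orP; right; apply/mapP; exists g.
Qed.

(** Conjugation by [t * s] sends the four base generators to listed ones. By the relators with [c],
    it sends each [g ^ (t * s)] to its conjugate by [c^-1], and [c] lies in [E]. *)
Lemma span_ts x : E x -> E (x ^ (t * s)).
Proof.
apply: span_conj => z; rewrite /generators /relgens mem_cat.
case/orP=> [/span_base_ts//|/mapP[g gb ->]].
have Ec : E c by apply: span_base; rewrite !inE eqxx.
have [_ [H _ _]] := relatorsP.
rewrite -[conj_op _ _ _ _]/(g ^ (t * s)) -(conjgK c ((g ^ _) ^ _)) H // conjgE.
apply: spanM; first by apply/spanV/spanV.
by apply: spanM; [apply: span_base_ts | apply: spanV].
Qed.

(** On generators, the relators with [d] replace [t^-1 * s] by [t * s] followed by conjugation by
    [d], an element of [E]. *)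
Lemma span_tVs x : E x -> E (x ^ (t^-1 * s)).
Proof.
apply: span_conj => z zg.
have Ed : E d by apply: span_base; rewrite !inE eqxx orbT.
have [_ [_ H _]] := relatorsP.
rewrite H // [_ ^ d]conjgE.
apply: spanM; first exact: spanV.
by apply: spanM => //; apply/span_ts/span_gen.
Qed.

Lemma span_commute_s x y : E x -> E y -> commute x (y ^ s).
Proof.
have [_ [_ _ H]] := relatorsP.
move=> Ex Ey; apply: (@span_commute _ [seq g ^ s | g <- generators]).
  move=> _ /mapP[g gE ->]; apply/commute_sym.
  by apply: span_commute Ex => h hE; apply/commute_sym/H.
by apply: span_conj Ey => z zg; apply/span_gen/mapP; exists z.
Qed.

(* [reduced b f]: f is the value of a reduced word in s and t, which starts with
   s if and only if b holds. *)
Inductive reduced : bool -> G -> Prop :=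
| red_1 : reduced false 1
| red_t : reduced false t
| red_tV : reduced false t^-1
| red_tM f : reduced true f -> reduced false (t * f)
| red_tVM f : reduced true f -> reduced false (t^-1 * f)
| red_sM f : reduced false f -> reduced true (s * f).

(** A new leading [t] or [t^-1] amounts to conjugation by [t^-1 * s] or [t * s], under which [E] is
    stable; a leading [s] exchanges [E] with its conjugate by [s]. Commutation with [t] settles the
    words without [s]. *)
Lemma reduced_conj q : E q -> commute (q ^ s) t -> forall b f, reduced b f ->
  E (if b then (q ^ s) ^ f^-1 else ((q ^ s) ^ f^-1) ^ s).
Proof.
move=> Eq qt.
have qsK x : (x ^ s) ^ s = x by rewrite -conjgM ss conjg1.
have fix_t x : commute (q ^ s) x -> (q ^ s) ^ x = q ^ s.
  by move=> h; apply/conjg_fixP/commgP.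
move=> b f; elim=> {b f} [|||f _|f _|f _].
- by rewrite invg1 conjg1 qsK.
- by rewrite fix_t ?qsK //; apply: commuteV.
- by rewrite invgK fix_t ?qsK.
- by move=> /span_tVs; rewrite invMg !conjgM.
- by move=> /span_ts; rewrite invMg invgK !conjgM.
- by rewrite invMg sV !conjgM.
Qed.

(** One word puts a conjugate of [q1] in [E], the other puts the same conjugate of [q2] in the
    conjugate of [E] by [s]. These commute, and so do [q1] and [q2]. *)
Lemma reduced_disjoint f : reduced true f -> reduced false f -> False.
Proof.
move=> rt rf; have [[_ _ [h1 h2]] _] := relatorsP; apply: ncomm.
have E1 : E q1 by apply: span_base; rewrite !inE eqxx !orbT.
have E2 : E q2 by apply: span_base; rewrite !inE eqxx !orbT.
have /= e1 := reduced_conj E1 h1 rt.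
have /= e2 := reduced_conj E2 h2 rf.
have := span_commute_s e1 e2.
rewrite -(conjgM _ s s) ss conjg1 => /commgP.
by rewrite -!conjRg !conjg_eq1 => /eqP.
Qed.

Lemma reduced_s b f : reduced b f -> reduced (~~ b) (s * f).
Proof.
case=> {b f} [|||f rf|f rf|f rf]; last by rewrite mulgA ss mul1g.
- exact/red_sM/red_1.
- exact/red_sM/red_t.
- exact/red_sM/red_tV.
- exact/red_sM/red_tM.
- exact/red_sM/red_tVM.
Qed.

Lemma reduced_t b f : reduced b f -> exists b', reduced b' (t * f).
Proof.
case=> {b f} [|||f rf|f rf|f rf].
- by rewrite mulg1; exists false; apply: red_t.
- by rewrite -tV; exists false; apply: red_tV.
- by rewrite mulgV; exists false; apply: red_1.
- by rewrite mulgA -tV; exists false; apply: red_tVM.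
- by rewrite mulVKg; exists true.
- by exists false; apply/red_tM/red_sM.
Qed.

Lemma reduced_span f : span [:: s; t] f -> exists b, reduced b f.
Proof.
(* Acting on arbitrary reduced words, by [f] and [f^-1] at once, lets the induction pass through
   products and inverses. *)
suff H : span [:: s; t] f -> forall b g, reduced b g ->
    (exists b', reduced b' (f * g)) /\ (exists b', reduced b' (f^-1 * g)).
  by move=> /H /(_ _ _ red_1) [+ _]; rewrite mulg1.
elim=> {f} [|f fS|x y _ IHx _ IHy|x _ IHx] b g rg.
- by rewrite invg1 mul1g; split; exists b.
- move: fS; rewrite !inE => /orP[] /eqP->.
    by rewrite sV; split; exists (~~ b); apply: reduced_s.
  have [b' r'] := reduced_t rg; split; first by exists b'.
  by rewrite tV -mulgA; apply: reduced_t r'.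
- rewrite invMg -!mulgA; split.
    by have [[b' r'] _] := IHy _ _ rg; apply: (IHx _ _ r').1.
  by have [_ [b' r']] := IHx _ _ rg; apply: (IHy _ _ r').2.
- by rewrite invgK; have [] := IHx _ _ rg.
Qed.

(* A coset representative is split off on the right, and A collects the elements
   whose remaining factor has a reduced word starting with s. *)
Lemma pingpong_set : exists A : pred G,
  [/\ forall g, ~~ A g -> A (s * g), forall g, A g -> ~~ A (t * g) &
      forall g, A g -> ~~ A (t * (t * g))].
Proof.
pose inF g h := `[< span [:: s; t] (g * h^-1) >].
pose rep g := choose (inF g) g.
have inFg g : inF g g by rewrite /inF mulgV; apply/asboolP/span1.
have inFrep g : span [:: s; t] (g * (rep g)^-1).
  by have /asboolP := chooseP (inFg g).
have rep_mul x g : span [:: s; t] x -> rep (x * g) = rep g.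
  move=> Fx.
  have eqF : inF (x * g) =1 inF g.
    move=> h; rewrite /inF -mulgA; apply: asbool_equiv_eq.
    split=> Fg; last exact: spanM.
    by rewrite -(mulKg x (g * _)); apply: spanM; first exact: spanV.
  (* The two predicates agree, and the default points [x * g] and [g] both satisfy them, so [choose]
     returns the same representative. *)
  by rewrite /rep (eq_choose eqF); apply: choose_id => //; rewrite -eqF.
have Fs : span [:: s; t] s by apply: span_gen; rewrite !inE eqxx.
have Ft : span [:: s; t] t by apply: span_gen; rewrite !inE eqxx orbT.
pose side b g := reduced b (g * (rep g)^-1).
have sideF g : `[< side true g >] -> side false g -> False.
  by move=> /asboolP; apply: reduced_disjoint.
exists (fun g => `[< side true g >]); split=> g.
- move=> Ag; apply/asboolP; rewrite /side rep_mul // -mulgA.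
  have [[] r] := reduced_span (inFrep g); last exact: red_sM.
  by move: Ag; rewrite (asboolT r).
- move=> /asboolP Ag; apply/negP => /sideF; apply.
  by rewrite /side rep_mul // -mulgA; apply: red_tM.
- move=> /asboolP Ag; apply/negP => /sideF; apply.
  by rewrite /side !rep_mul // mulgA -tV -mulgA; apply: red_tVM.
Qed.

End PingPong.

(** * Counting in finite sets *)

(** An element of [H] satisfying [P] either is [g * k] with [k] in [H], or lies in [H] outside the
    translate. *)
Lemma card_translate_pred (G : groupType) (H : {fset G}) (g : G) (P : pred G) :
  (#|` [fset h in H | P h]%fset| <=
   #|` [fset h in H | P (g * h)%g]%fset| + #|` symdiff (ltranslate g H) H|)%N.
Proof.
set B := [fset h in H | P (g * h)%g]%fset.
set D := symdiff _ _.
apply: (@leq_trans #|` ltranslate g B `|` D|%fset).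
  apply/fsubset_leq_card/fsubsetP => h; rewrite !inE /= => /andP[hH Ph].
  have [gH|gH] := boolP (h \in ltranslate g H); last by rewrite hH orbT.
  apply/orP; left; have /imfsetP[/= k kH hk] := gH.
  by apply/imfsetP; exists k => //=; rewrite !inE /= kH -hk Ph.
rewrite cardfsU (leq_trans (leq_subr _ _)) // leq_add2r.
exact: leq_imfset_card.
Qed.

(** Up to boundary terms, [s] makes the part of [H] outside [A] no larger than the part inside,
    while [t] and [t * t] fit two disjoint copies of the inside part into the outside one. *)
Lemma pingpong_card (G : groupType) (s t : G) (A : pred G) (H : {fset G}) :
  s * s = 1 ->
  (forall g, ~~ A g -> A (s * g)) -> (forall g, A g -> ~~ A (t * g)) ->
  (forall g, A g -> ~~ A (t * (t * g))) ->
  (#|` H| <= 3 * #|` symdiff (ltranslate s H) H| +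
             6 * #|` symdiff (ltranslate t H) H|)%N.
Proof.
move=> ss sA tA ttA.
have cs := card_translate_pred H s (predC A).
have ct := card_translate_pred H t A.
have ctt := card_translate_pred H t (fun g => A (t * g)).
have cA : (#|` H| = #|` [fset h in H | A h]%fset| +
                    #|` [fset h in H | ~~ A h]%fset|)%N.
  rewrite -cardfsUI; set I := (_ `&` _)%fset.
  have -> : I = fset0.
    by apply/fsetP => h; rewrite !inE /=; case: (A h); rewrite ?andbF.
  rewrite cardfs0 addn0; congr #|` _|.
  apply/fsetP => h; rewrite !inE /=.
  by case: (A h); rewrite ?andbT ?andbF ?orbF.
have c1 : (#|` [fset h in H | ~~ A (s * h)%g]%fset| <=
           #|` [fset h in H | A h]%fset|)%N.
  apply/fsubset_leq_card/fsubsetP => h; rewrite !inE /= => /andP[-> /sA].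
  by rewrite mulgA ss mul1g.
have c2 : (#|` [fset h in H | A (t * h)%g]%fset| +
           #|` [fset h in H | A (t * (t * h))%g]%fset| <=
           #|` [fset h in H | ~~ A h]%fset|)%N.
  rewrite -cardfsUI; set I := (_ `&` _)%fset.
  have -> : I = fset0.
    apply/fsetP => h; rewrite !inE /=; apply/negP => /andP[/andP[_ Ath]].
    by move=> /andP[_]; apply/negP/tA.
  rewrite cardfs0 addn0; apply/fsubset_leq_card/fsubsetP => h.
  rewrite !inE /= -andb_orr => /andP[-> /= h2]; apply/negP => Ah.
  by case/orP: h2; apply/negP; [apply: tA | apply: ttA].
(* The premises give [2a <= b + 3n] and [b <= a + m], hence [a <= m + 3n] and [b <= 2m + 3n]. *)
have arith a b x p q m n : (b <= x + m -> a <= p + n -> p <= q + n -> x <= a ->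
    p + q <= b -> a + b <= 3 * m + 6 * n)%N by lia.
rewrite cA; exact: arith cs ct ctt c1 c2.
Qed.

(** * The group of permutations of a type *)

(** Storing the inverse makes the group inverse compute, so that identities in the model reduce to
    case analysis. *)
Record bijection (X : Type) := Bijection {
  bij_fun :> X -> X;
  bij_inv : X -> X;
  bij_funK : cancel bij_fun bij_inv;
  bij_invK : cancel bij_inv bij_fun
}.

Lemma bijection_eq (X : Type) (f g : bijection X) : f =1 g -> f = g.
Proof.
case: f g => [f f' fK f'K] [g g' gK g'K] /= /funext fg.
case: _ / fg in gK g'K *.
have fg' : f' = g' by apply/funext => x; rewrite -{1}(g'K x) fK.
by case: _ / fg' in gK g'K *; congr Bijection; apply: Prop_irrelevance.
Qed.

HB.instance Definition _ (X : Type) := gen_eqMixin (bijection X).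
HB.instance Definition _ (X : Type) := gen_choiceMixin (bijection X).

Section Symmetric.
Variable X : Type.

Definition bij_one : bijection X := @Bijection X id id (frefl _) (frefl _).
Definition bij_opp (f : bijection X) : bijection X :=
  Bijection (@bij_invK _ f) (@bij_funK _ f).
(** The right factor acts first, so [x ^ y] applies [y], then [x], then the inverse of [y]. *)
Definition bij_mul (f g : bijection X) : bijection X :=
  Bijection (can_comp (@bij_funK _ f) (@bij_funK _ g))
            (can_comp (@bij_invK _ g) (@bij_invK _ f)).

Lemma bij_mulA : associative bij_mul.
Proof. by move=> f g h; apply: bijection_eq. Qed.
Lemma bij_mul1 : left_id bij_one bij_mul.
Proof. by move=> f; apply: bijection_eq. Qed.
Lemma bij_mulr1 : right_id bij_one bij_mul.
Proof. by move=> f; apply: bijection_eq. Qed.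
Lemma bij_mulV : left_inverse bij_one bij_opp bij_mul.
Proof. by move=> f; apply: bijection_eq => x; apply: bij_funK. Qed.
Lemma bij_mulrV : right_inverse bij_one bij_opp bij_mul.
Proof. by move=> f; apply: bijection_eq => x; apply: bij_invK. Qed.

HB.instance Definition _ := isGroup.Build (bijection X)
  bij_mulA bij_mul1 bij_mulr1 bij_mulV bij_mulrV.

End Symmetric.

(** * A model of the relators on binary trees *)

Inductive three := Y1 | Y2 | Y3.
(* An element of [tree] is a path of left and right turns with a marked end. The
   permutation perm_t rotates three copies of [tree], and perm_s exchanges the
   copy P0 with the rest of the space, following tree = three + tree + tree. *)
Inductive tree := Leaf of three | Lft of tree | Rgt of tree.
Inductive space := Base of three | P0 of tree | P1 of tree | P2 of tree.

Definition s_fun x := match x with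
  | P0 (Leaf y) => Base y | Base y => P0 (Leaf y)
  | P0 (Lft w) => P1 w | P1 w => P0 (Lft w)
  | P0 (Rgt w) => P2 w | P2 w => P0 (Rgt w)
  end.
Definition t_fun x := match x with
  | Base y => Base y | P0 w => P2 w | P1 w => P0 w | P2 w => P1 w end.
Definition t_inv x := match x with
  | Base y => Base y | P0 w => P1 w | P1 w => P2 w | P2 w => P0 w end.

Fact s_funK : involutive s_fun. Proof. by case=> [|[]||]. Qed.
Fact t_funK : cancel t_fun t_inv. Proof. by case. Qed.
Fact t_invK : cancel t_inv t_fun. Proof. by case. Qed.
Definition perm_s := Bijection s_funK s_funK.
Definition perm_t := Bijection t_funK t_invK.

(* Moving the left subtree onto its own left subtree makes c undo one of two
   successive passages from a permutation k to [lft k]. *)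
Definition c_fun w := match w with
  | Leaf y => Leaf y
  | Lft w => Lft (Lft w)
  | Rgt (Leaf y) => Lft (Leaf y)
  | Rgt (Lft w) => Lft (Rgt w)
  | Rgt (Rgt w) => Rgt w
  end.
Definition c_inv w := match w with
  | Leaf y => Leaf y
  | Lft (Lft w) => Lft w
  | Lft (Leaf y) => Rgt (Leaf y)
  | Lft (Rgt w) => Rgt (Lft w)
  | Rgt w => Rgt (Rgt w)
  end.
Definition d_fun w := match w with
  | Leaf y => Leaf y | Lft w => Rgt w | Rgt w => Lft w end.
Definition q1_fun w := match w with
  | Leaf Y1 => Leaf Y2 | Leaf Y2 => Leaf Y1 | w => w end.
Definition q2_fun w := match w with
  | Leaf Y2 => Leaf Y3 | Leaf Y3 => Leaf Y2 | w => w end.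

Fact c_funK : cancel c_fun c_inv. Proof. by case=> [||[]]. Qed.
Fact c_invK : cancel c_inv c_fun. Proof. by case=> [|[]|]. Qed.
Fact d_funK : involutive d_fun. Proof. by case. Qed.
Fact q1_funK : involutive q1_fun. Proof. by case=> [[]||]. Qed.
Fact q2_funK : involutive q2_fun. Proof. by case=> [[]||]. Qed.

Section Extensions.
Variable k : bijection tree.

Definition ext_fun (f : tree -> tree) x := if x is P0 w then P0 (f w) else x.
Definition lft_fun (f : tree -> tree) w :=
  if w is Lft w' then Lft (f w') else w.

Fact ext_funK : cancel (ext_fun k) (ext_fun (bij_inv k)).
Proof. by case=> //= w; rewrite bij_funK. Qed.
Fact ext_invK : cancel (ext_fun (bij_inv k)) (ext_fun k).
Proof. by case=> //= w; rewrite bij_invK. Qed.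
Fact lft_funK : cancel (lft_fun k) (lft_fun (bij_inv k)).
Proof. by case=> //= w; rewrite bij_funK. Qed.
Fact lft_invK : cancel (lft_fun (bij_inv k)) (lft_fun k).
Proof. by case=> //= w; rewrite bij_invK. Qed.

Definition ext := Bijection ext_funK ext_invK.
Definition lft := Bijection lft_funK lft_invK.

End Extensions.

Definition perm_c := Bijection c_funK c_invK.
Definition perm_d := Bijection d_funK d_funK.
Definition perm_q1 := Bijection q1_funK q1_funK.
Definition perm_q2 := Bijection q2_funK q2_funK.

(** The product [perm_t * perm_s] carries the left subtree of [P0] onto all of [P0]. *)
Lemma ext_ts k : ext k ^ (perm_t * perm_s) = ext (lft k).
Proof. by apply: bijection_eq; case=> [|[]||]. Qed.

(** With [perm_t^-1] it is the right subtree that is carried onto [P0], and [perm_d] swaps the two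
    subtrees. *)
Lemma ext_tVs k : ext k ^ (perm_t^-1 * perm_s) = ext (lft k) ^ ext perm_d.
Proof. by apply: bijection_eq; case=> [|[]||]. Qed.

Lemma ext_c k : ext (lft (lft k)) ^ ext perm_c = ext (lft k).
Proof. by apply: bijection_eq; case=> [|[|[]|[]]||]. Qed.

(** The supports are disjoint: [ext k] moves only points of [P0], and [perm_s] exchanges [P0] with
    its complement. *)
Lemma ext_comm k l : commute (ext k) (ext l ^ perm_s).
Proof.
apply: bijection_eq; case=> [y|w|w|w] /=.
- rewrite -[LHS]/(ext_fun k (s_fun (P0 (l (Leaf y))))).
  rewrite -[RHS]/(s_fun (P0 (l (Leaf y)))).
  by case: (l _).
- rewrite -[LHS]/(ext_fun k (s_fun (ext_fun l (s_fun (P0 w))))).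
  rewrite -[RHS]/(s_fun (ext_fun l (s_fun (P0 (k w))))).
  by case: w => [y|w|w] /=; case: (k _).
- rewrite -[LHS]/(ext_fun k (s_fun (P0 (l (Lft w))))).
  rewrite -[RHS]/(s_fun (P0 (l (Lft w)))).
  by case: (l _).
- rewrite -[LHS]/(ext_fun k (s_fun (P0 (l (Rgt w))))).
  rewrite -[RHS]/(s_fun (P0 (l (Rgt w)))).
  by case: (l _).
Qed.

Lemma model_relators :
  all (eq_op^~ 1) (relators *%g (@inv (bijection space)) perm_s perm_t
                     (ext perm_c) (ext perm_d) (ext perm_q1) (ext perm_q2)).
Proof.
rewrite /relators.
(* Once all generators have the form [ext k], the last block of relators is an instance of
   [ext_comm]. *)
have [ks ->] : exists ks, relgens *%g (@inv (bijection space)) perm_s perm_t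
    (ext perm_c) (ext perm_d) (ext perm_q1) (ext perm_q2) = map ext ks.
  pose base := [:: perm_c; perm_d; perm_q1; perm_q2].
  by exists (base ++ map lft base); rewrite /= -!ext_ts.
rewrite !all_cat; apply/and4P; split.
- apply/and5P; split=> //.
  + by apply/eqP/bijection_eq; apply: s_funK.
  + by apply/eqP/bijection_eq; case.
  + by apply/commgP/bijection_eq; case=> [[]|[[]||]|[[]||]|].
  + by apply/commgP/bijection_eq; case=> [[]|[[]||]|[[]||]|].
- have rel k : (((ext k ^ (perm_t * perm_s)) ^ (perm_t * perm_s)) ^ ext perm_c)
      * (ext k ^ (perm_t * perm_s))^-1 == 1.
    by rewrite !ext_ts ext_c mulgV.
  rewrite -[[:: ext perm_c; _; _; _]]/(map ext [:: _; _; _; _]) -map_comp.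
  by rewrite all_map; apply/allP => k _; apply: rel.
- rewrite -map_comp all_map; apply/allP => k _.
  have rel : (ext k ^ (perm_t^-1 * perm_s)) *
      ((ext k ^ (perm_t * perm_s)) ^ ext perm_d)^-1 == 1.
    by rewrite ext_ts ext_tVs mulgV.
  exact: rel.
- rewrite allpairs_mapl allpairs_mapr; apply/all_allpairsP => k l _ _.
  exact/commgP/ext_comm.
Qed.

Lemma model_inequation : [~ ext perm_q1, ext perm_q2] <> 1.
Proof. by move=> /(congr1 (fun f : bijection space => f (P0 (Leaf Y1)))). Qed.

Definition word_var (X : Type) (x : X) : word X := [:: (x, false)].
Definition word_inv (X : Type) (w : word X) : word X :=
  rev [seq (l.1, ~~ l.2) | l <- w].

Section EvalWord.
Variables (X : Type) (G : groupType) (v : X -> G).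

Lemma eval_word_var x : eval_word v (word_var x) = v x.
Proof. by rewrite /eval_word big_seq1. Qed.

Lemma eval_word_cat : {morph eval_word v : w1 w2 / w1 ++ w2 >-> w1 * w2}.
Proof. by move=> w1 w2; rewrite /eval_word big_cat. Qed.

Lemma eval_word_inv : {morph eval_word v : w / word_inv w >-> w^-1}.
Proof.
elim=> [|[x b] w IHw]; first by rewrite /eval_word !big_nil invg1.
rewrite /word_inv /= rev_cons -cats1 eval_word_cat -/(word_inv w) IHw.
by rewrite /eval_word big_seq1 big_cons invMg; case: b; rewrite /= ?invgK.
Qed.

Lemma eval_word_rename (Y : Type) (f : Y -> X) w :
  eval_word v (rename_word f w) = eval_word (v \o f) w.
Proof. by rewrite /eval_word big_map. Qed.

Lemma eval_word_morph (H : groupType) (e : G -> H) w :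
  e 1 = 1 -> {morph e : x y / x * y} -> {morph e : x / x^-1} ->
  eval_word (e \o v) w = e (eval_word v w).
Proof.
move=> e1 eM eV; rewrite /eval_word (big_morph e eM e1).
by apply: eq_bigr => -[x []] _ /=; rewrite ?eV.
Qed.

End EvalWord.

Section PingPongSystem.
Variable W : finType.
Let X : Type := (W + 'I_4 + 'I_2)%type.
Let xvar (i : 'I_2) : word X := word_var (inr i).
Let zvar (i : 'I_4) : word X := word_var (inl (inr i)).
Let z i : 'I_4 := @inord 3 i.
Let x i : 'I_2 := @inord 1 i.

Definition pingpong_relators :=
  relators cat (@word_inv X) (xvar (x 0)) (xvar (x 1))
    (zvar (z 0)) (zvar (z 1)) (zvar (z 2)) (zvar (z 3)).

Definition pingpong_system (S0 : system W) : system (W + 'I_4 + 'I_2) :=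
  let S := rename_system (fun w : W => inl (inl w)) S0 in
  System
    (equations S ++ pingpong_relators)
    (comm_op cat (@word_inv X) (zvar (z 2)) (zvar (z 3)) :: inequations S).

Lemma eval_pingpong_relators (G : groupType) (v : X -> G) :
  map (eval_word v) pingpong_relators =
  relators *%g (@inv G) (v (inr (x 0))) (v (inr (x 1)))
    (v (inl (inr (z 0)))) (v (inl (inr (z 1))))
    (v (inl (inr (z 2)))) (v (inl (inr (z 3)))).
Proof.
have evalM := eval_word_cat v; have evalV := eval_word_inv v.
rewrite /pingpong_relators (map_relators _ _ _ _ _ _ evalM evalV).
by rewrite !eval_word_var.
Qed.

Lemma eval_pingpong_inequation (G : groupType) (v : X -> G) :
  eval_word v (comm_op cat (@word_inv X) (zvar (z 2)) (zvar (z 3))) =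
  [~ v (inl (inr (z 2))), v (inl (inr (z 3)))].
Proof.
by rewrite /comm_op /conj_op !(eval_word_cat, eval_word_inv) !eval_word_var.
Qed.

Lemma pingpong_system_solvable (S0 : system W) :
  solvable_in_some_group S0 -> solvable_in_some_group (pingpong_system S0).
Proof.
move=> [G0 [b [beq bneq]]].
pose H := (G0 * bijection space)%type.
pose zs := [:: ext perm_c; ext perm_d; ext perm_q1; ext perm_q2].
pose eR (y : bijection space) : H := (1, y).
pose eL (y : G0) : H := (y, 1).
have eRM : {morph eR : y y' / y * y'}.
  by move=> y y'; rewrite /eR; congr pair; rewrite /= mulg1.
have eRV : {morph eR : y / y^-1} by move=> y; congr pair; rewrite /= invg1.
have eLM : {morph eL : y y' / y * y'}.
  by move=> y y'; congr pair; rewrite /= mulg1.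
have eLV : {morph eL : y / y^-1} by move=> y; congr pair; rewrite /= invg1.
pose v := assignment3 (eL \o b) (fun i : 'I_4 => eR (nth 1 zs i))
            (fun i : 'I_2 => eR (if i == ord0 then perm_s else perm_t)).
exists H, v; split=> w.
- rewrite mem_cat => /orP[/mapP[u uS ->]|wR].
    rewrite eval_word_rename -[v \o _]/(eL \o b) eval_word_morph //.
    by rewrite beq.
  have : eval_word v w \in map (eval_word v) pingpong_relators.
    exact: map_f.
  rewrite eval_pingpong_relators /= -[x 0 == _]val_eqE -[x 1 == _]val_eqE.
  rewrite /= !inordK //= -(map_relators _ _ _ _ _ _ eRM eRV).
  by case/mapP => y /(allP model_relators) /eqP-> ->.
- rewrite inE => /orP[/eqP->|/mapP[u uS ->]].
    rewrite eval_pingpong_inequation /= !inordK //= => /(congr1 snd).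
    exact: model_inequation.
  rewrite eval_word_rename -[v \o _]/(eL \o b) eval_word_morph //.
  by move=> /(congr1 fst) /=; apply: bneq.
Qed.

Lemma pingpong_system_card (S0 : system W) (G : groupType) (v : X -> G)
    (H : {fset G}) :
  is_solution (pingpong_system S0) v ->
  (#|` H| <= 3 * #|` symdiff (ltranslate (v (inr (x 0))) H) H| +
             6 * #|` symdiff (ltranslate (v (inr (x 1))) H) H|)%N.
Proof.
move=> [veq vneq].
have rel : all (eq_op^~ 1) (relators *%g (@inv G)
    (v (inr (x 0))) (v (inr (x 1)))
    (v (inl (inr (z 0)))) (v (inl (inr (z 1))))
    (v (inl (inr (z 2)))) (v (inl (inr (z 3))))).
  rewrite -eval_pingpong_relators all_map; apply/allP => w wR /=.
  by apply/eqP/veq; rewrite mem_cat wR orbT.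
have ncomm : [~ v (inl (inr (z 2))), v (inl (inr (z 3)))] <> 1.
  by rewrite -eval_pingpong_inequation; apply: vneq; rewrite inE eqxx.
have [A [sA tA ttA]] := pingpong_set rel ncomm.
have [[ss _ _] _] := relatorsP rel.
exact: pingpong_card ss sA tA ttA.
Qed.

End PingPongSystem.

Theorem corollary3p2p7 (R : realType) :
  exists (n : nat) (eps : R), (0 < eps)%R /\
    forall (W : finType) (S0 : system W), solvable_in_some_group S0 ->
      exists (Z : finType) (S : system (W + Z + 'I_n)%type),
        [/\ solvable_in_some_group S,
            subsystem (rename_system (fun w : W => inl (inl w)) S0) S &
            forall (G : groupType) (a : 'I_n -> G),
              (exists (b : W -> G) (c : Z -> G),
                  is_solution S (assignment3 b c a)) ->
              ~ exists H : {fset G}, tuple_Folner a eps H].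
Proof.
exists 2, (9%:R^-1)%R; split; first by rewrite invr_gt0 ltr0n.
move=> W S0 S0sol; exists 'I_4, (pingpong_system S0); split.
- exact: pingpong_system_solvable.
- by split=> w wS; [rewrite mem_cat wS | rewrite inE wS orbT].
- move=> G a [b [c sol]] [H FH].
  have := pingpong_system_card H sol.
  have := FH (a (inord 0)) (in_imfset _ _ _).
  have := FH (a (inord 1)) (in_imfset _ _ _).
  rewrite -(ler_nat R) natrD !natrM /= => /(_ isT) h1 /(_ isT) h0 h.
  lra.
Qed.
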